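(* Let $q^-\le q^+$ be projections in $N$ such that $F=\Psi([q^-,q^+])$ is a face of the spectral scale $B$. Let $\mathbf t\in\mathbb R^n$ be nonzero and let $s_1<s_2$ be real numbers such that $(-s_1,\mathbf t)$ and $(-s_2,\mathbf t)$ are in $K_F$. Then (1) the interval $(s_1,s_2)$ lies in a gap in the spectrum of $b_{\mathbf t}$ (that is, it is disjoint from the spectrum of $b_{\mathbf t}$), and (2) $F$ is an exposed point of $B$.
   Context: $M$ is a finite von Neumann algebra with a faithful normal tracial state $\tau$, $n$ is a positive integer, and $b_1,\dots,b_n\in M$ are self-adjoint; $N$ is the von Neumann subalgebra of $M$ generated by $b_1,\dots,b_n$ and $1$. $M_1^+=\{a\in M:0\le a\le 1\}$, $\Psi(a)=(\tau(a),\tau(b_1a),\dots,\tau(b_na))$, and $B=\Psi(M_1^+)\subset\mathbb R^{n+1}$ (the spectral scale) is compact and convex. For projections $p\le q$ in $M$, $[p,q]=\{a\in M_1^+:p\le a\le q\}$. (Every face of $B$ is of the form $\Psi([q^-,q^+])$ with $q^-\le q^+$ projections in $N$.) For nonzero $\mathbf t\in\mathbb R^n$, $b_{\mathbf t}=t_1b_1+\cdots+t_nb_n$. The normal cone $K_F$ of a nonempty face $F$ of $B$ is the set of nonzero vectors $\mathbf v\in\mathbb R^{n+1}$ for which there is a real $\alpha$ such that the hyperplane $\{\mathbf x:\langle\mathbf v,\mathbf x\rangle=\alpha\}$ is a hyperplane of support for $B$ that contains $F$ and $B\subset\{\mathbf x:\langle\mathbf v,\mathbf x\rangle\ge\alpha\}$.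 An exposed point of $B$ is a point $\mathbf x$ with $\{\mathbf x\}=B\cap P$ for some hyperplane of support $P$ for $B$; ''$F$ is an exposed point'' means $F=\{\mathbf x\}$ for such $\mathbf x$. *)

(* Defs.v *)
From HB Require Import structures.
From mathcomp Require Import all_boot all_order all_algebra.
From mathcomp Require Import all_classical all_reals all_analysis.
From mathcomp Require Import complex.

Set Implicit Arguments.
Unset Strict Implicit.
Unset Printing Implicit Defensive.

Import Order.TTheory GRing.Theory Num.Theory.
Import numFieldNormedType.Exports.

Local Open Scope classical_set_scope.
Local Open Scope ring_scope.
Local Open Scope complex_scope.

(* A Hilbert space is a complete normed space over R[i] with a positive       *)
(* definite sesquilinear form (linear in its first argument) inducing its     *)
(* norm.  Operators are plain functions H -> H: their vector space operations *)
(* are pointwise, their product is \o, and the unit is id.                    *)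

Definition hilbert (R : realType) (H : completeNormedModType R[i])
    (form : {dot H for Num.conj}) : Prop :=
  forall x : H, `|x| ^+ 2 = form x x.

Definition bounded_op (R : realType) (H : completeNormedModType R[i])
    (a : H -> H) : Prop :=
  linear a /\ exists c : R[i], forall x, `|a x| <= c * `|x|.

Definition is_adjoint (R : realType) (H : completeNormedModType R[i])
    (form : {dot H for Num.conj}) (a c : H -> H) : Prop :=
  forall x y, form (a x) y = form x (c y).

Definition selfadjoint (R : realType) (H : completeNormedModType R[i])
    (form : {dot H for Num.conj}) (a : H -> H) : Prop :=
  is_adjoint form a a.

Definition projection (R : realType) (H : completeNormedModType R[i])
    (form : {dot H for Num.conj}) (p : H -> H) : Prop :=
  selfadjoint form p /\ p \o p = p.

(* In R[i], [0 <= z] means that z is real and nonnegative. *)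
Definition op_ge0 (R : realType) (H : completeNormedModType R[i])
    (form : {dot H for Num.conj}) (a : H -> H) : Prop :=
  forall x, 0 <= form (a x) x.

Definition op_le (R : realType) (H : completeNormedModType R[i])
    (form : {dot H for Num.conj}) (a c : H -> H) : Prop :=
  op_ge0 form (c - a).

Definition star_subalgebra (R : realType) (H : completeNormedModType R[i])
    (form : {dot H for Num.conj}) (M : set (H -> H)) : Prop :=
  [/\ M `<=` @bounded_op R H,
      M id,
      forall (k : R[i]) a c, M a -> M c -> M (k *: a + c),
      forall a c, M a -> M c -> M (a \o c)
    & forall a, M a -> exists2 c, M c & is_adjoint form a c].

(* Closedness in B(H) for the weak operator topology. *)
Definition wot_closed (R : realType) (H : completeNormedModType R[i])
    (form : {dot H for Num.conj}) (M : set (H -> H)) : Prop :=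
  forall (F : set_system (H -> H)) (a : H -> H),
    ProperFilter F -> F M -> bounded_op a ->
    (forall x y, (fun c : H -> H => form (c x) y) @ F --> form (a x) y) ->
    M a.

Definition von_neumann_algebra (R : realType) (H : completeNormedModType R[i])
    (form : {dot H for Num.conj}) (M : set (H -> H)) : Prop :=
  star_subalgebra form M /\ wot_closed form M.

(* The von Neumann algebra generated by the b i and 1 (which belongs to every *)
(* von Neumann algebra).                                                      *)
Definition generated_vna (R : realType) (H : completeNormedModType R[i])
    (form : {dot H for Num.conj}) (n : nat) (b : 'I_n -> H -> H) :
    set (H -> H) :=
  [set a | forall N, von_neumann_algebra form N -> (forall i, N (b i)) -> N a].

(* The unit is a finite projection: v^* v = 1 implies v v^* = 1. *)
Definition finite_vna (R : realType) (H : completeNormedModType R[i])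
    (form : {dot H for Num.conj}) (M : set (H -> H)) : Prop :=
  forall v w, M v -> M w -> is_adjoint form v w ->
    w \o v = id -> v \o w = id.

Definition tracial_state (R : realType) (H : completeNormedModType R[i])
    (form : {dot H for Num.conj}) (M : set (H -> H))
    (tau : (H -> H) -> R[i]) : Prop :=
  [/\ forall (k : R[i]) a c, M a -> M c -> tau (k *: a + c) = k * tau a + tau c,
      forall a, M a -> op_ge0 form a -> 0 <= tau a,
      tau id = 1
    & forall a c, M a -> M c -> tau (a \o c) = tau (c \o a)].

Definition faithful (R : realType) (H : completeNormedModType R[i])
    (form : {dot H for Num.conj}) (M : set (H -> H))
    (tau : (H -> H) -> R[i]) : Prop :=
  forall a, M a -> op_ge0 form a -> tau a = 0 -> a = 0.

Definition op_lub (R : realType) (H : completeNormedModType R[i])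
    (form : {dot H for Num.conj}) (M D : set (H -> H)) (s : H -> H) : Prop :=
  [/\ M s, selfadjoint form s, forall d, D d -> op_le form d s
    & forall u, M u -> selfadjoint form u ->
        (forall d, D d -> op_le form d u) -> op_le form s u].

(* tau (sup D) = sup (tau D) for upward directed sets D of self-adjoint       *)
(* elements having a supremum in M.                                           *)
Definition normal (R : realType) (H : completeNormedModType R[i])
    (form : {dot H for Num.conj}) (M : set (H -> H))
    (tau : (H -> H) -> R[i]) : Prop :=
  forall (D : set (H -> H)) (s : H -> H),
    D !=set0 ->
    (forall d, D d -> M d /\ selfadjoint form d) ->
    (forall d e, D d -> D e ->
       exists f, [/\ D f, op_le form d f & op_le form e f]) ->
    op_lub form M D s ->
    complex.Re (tau s) = sup [set complex.Re (tau d) | d in D].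

Definition invertible_in (R : realType) (H : completeNormedModType R[i])
    (M : set (H -> H)) (a : H -> H) : Prop :=
  exists c, [/\ M c, c \o a = id & a \o c = id].

Definition spectrum (R : realType) (H : completeNormedModType R[i])
    (M : set (H -> H)) (a : H -> H) : set R[i] :=
  [set l | ~ invertible_in M (a - l *: (id : H -> H))].

Definition unit_interval (R : realType) (H : completeNormedModType R[i])
    (form : {dot H for Num.conj}) (M : set (H -> H)) : set (H -> H) :=
  [set a | [/\ M a, op_le form 0 a & op_le form a id]].

Definition op_itv (R : realType) (H : completeNormedModType R[i])
    (form : {dot H for Num.conj}) (M : set (H -> H)) (p q : H -> H) :
    set (H -> H) :=
  [set a | [/\ unit_interval form M a, op_le form p a & op_le form a q]].

(* tau (b i a) is real when tau is a trace, b i is self-adjoint and a >= 0,   *)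
(* so that taking real parts loses nothing.                                   *)
Definition spectral_map (R : realType) (H : completeNormedModType R[i])
    (tau : (H -> H) -> R[i]) (n : nat) (b : 'I_n -> H -> H) (a : H -> H) :
    'rV[R]_(1 + n) :=
  row_mx (complex.Re (tau a))%:M (\row_i complex.Re (tau (b i \o a))).

Definition spectral_scale (R : realType) (H : completeNormedModType R[i])
    (form : {dot H for Num.conj}) (M : set (H -> H))
    (tau : (H -> H) -> R[i]) (n : nat) (b : 'I_n -> H -> H) :
    set 'rV[R]_(1 + n) :=
  spectral_map tau b @` unit_interval form M.

Definition lin_comb (R : realType) (H : completeNormedModType R[i])
    (n : nat) (b : 'I_n -> H -> H) (t : 'rV[R]_n) : H -> H :=
  \sum_i (t 0 i)%:C *: b i.

Definition dotv (R : realType) (m : nat) (v x : 'rV[R]_m) : R :=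
  \sum_i v 0 i * x 0 i.

Definition hyperplane (R : realType) (m : nat) (v : 'rV[R]_m) (alpha : R) :
    set 'rV[R]_m :=
  [set x | dotv v x = alpha].

Definition halfspace (R : realType) (m : nat) (v : 'rV[R]_m) (alpha : R) :
    set 'rV[R]_m :=
  [set x | alpha <= dotv v x].

(* Replacing v by - v covers both sides of P. *)
Definition support_hyperplane (R : realType) (m : nat) (B P : set 'rV[R]_m) :
    Prop :=
  exists v alpha, [/\ v != 0, P = hyperplane v alpha,
    B `<=` halfspace v alpha & B `&` P !=set0].

Definition face (R : realType) (m : nat) (B F : set 'rV[R]_m) : Prop :=
  [/\ F `<=` B, convex_set F
    & forall (x y : 'rV[R]_m) (l : R), B x -> B y -> 0 < l < 1 ->
        F (l *: x + (1 - l) *: y) -> F x /\ F y].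

Definition normal_cone (R : realType) (m : nat) (B F : set 'rV[R]_m) :
    set 'rV[R]_m :=
  [set v | v != 0 /\ exists alpha,
    [/\ support_hyperplane B (hyperplane v alpha), F `<=` hyperplane v alpha
      & B `<=` halfspace v alpha]].

Definition exposed_point (R : realType) (m : nat) (B : set 'rV[R]_m)
    (x : 'rV[R]_m) : Prop :=
  exists2 P, support_hyperplane B P & [set x] = B `&` P.

(* Main.v *)
Require Import Defs.
From HB Require Import structures.
From mathcomp Require Import all_boot all_order all_algebra.
From mathcomp Require Import all_classical all_reals all_analysis.
From mathcomp Require Import complex.
From mathcomp Require Import ring lra.

(** Write c for b_t, q for q^- and rho for the real part of tau.  That (-s, t)
    lies in the normal cone of F means that every a with Psi(a) in F minimizes
    rho((c - s) a) over the unit interval 0 <= a <= 1 of M; in particular q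
    does, for s = s1 and for s = s2.

    F is a point: for a in [q^-, q^+] the values of rho(c a) - s1 rho(a) and of
    rho(c a) - s2 rho(a) are those at q, so rho(a - q) = 0, and faithfulness
    of the trace gives a = q.

    The rest exploits the first order conditions at a minimizing
    projection q, with no spectral theorem.  Put p = 1 - q and x = c - s.
    - Rotating q infinitesimally along the skew-adjoint k = [x, q] changes
      rho(x q) at first order by - rho(k^2) = rho(k^* k), up to sign; minimality
      forces it to vanish, so x commutes with q ([minimizer_comm]).
    - Removing q h q from q, or adding p h p to it, gives rho(x q h q) <= 0 and
      rho(x p h p) >= 0 for 0 <= h <= 1 ([minimizer_rho_le0],
      [minimizer_rho_ge0]).
    If a also minimizes both functionals, the four quantities obtained from
    h = 1 - a and h = a at s1 and s2 all vanish; subtracting,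
    rho(q (1 - a) q) = rho(p a p) = 0, hence (1 - a) q = a p = 0 and a = q
    ([two_minimizers_unique]).  Since a point of B on the hyperplane normal to
    (-s, t), s = (s1 + s2) / 2, is such an a, F is exposed.

    For s1 < s < s2 let y = c - s and Z = y (p - q).  Comparing y with c - s1 on
    q and with c - s2 on p, rho(Z h) >= d rho(h) for all h >= 0, with
    d = min (s - s1, s2 - s).  An element D with rho(D h) >= 0 for all h >= 0 is
    positive ([pos_of_rho]); this is where a square root of D^2 inside M is
    needed.  So Z >= d > 0 is invertible in M by a Neumann series ([inv_ex]), and
    so is y = Z (p - q) ([two_minimizers_gap]).

    Both the square root and the inverse are norm limits of iterations dominated
    by increasing bounded real sequences ([norm_cvg_ex]); completeness of the
    Hilbert space gives the limit and weak closedness of M keeps it in M. *)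

Set Implicit Arguments.
Unset Strict Implicit.
Unset Printing Implicit Defensive.

Import Order.TTheory GRing.Theory Num.Theory.
Import numFieldNormedType.Exports.

Local Open Scope classical_set_scope.
Local Open Scope ring_scope.
Local Open Scope complex_scope.

(** * The *-algebra M as a ring *)

Section StarSubalgebra.
Context (R : realType) (H : completeNormedModType R[i]).
Context (form : {dot H for Num.conj}) (M : set (H -> H)).
Context (hM : star_subalgebra form M).

Lemma star_subalgebra_linear a : M a -> linear a.
Proof. by case: hM => bM _ _ _ _ /bM[]. Qed.

Lemma star_subalgebra1 : M id.
Proof. by case: hM. Qed.

Lemma star_subalgebraP (k : R[i]) a c : M a -> M c -> M (k *: a + c).
Proof. by case: hM => _ _ h _ _; exact: h. Qed.

Lemma star_subalgebra0 : M 0.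
Proof.
have := star_subalgebraP (-1) star_subalgebra1 star_subalgebra1.
by rewrite scaleN1r addNr.
Qed.

Lemma star_subalgebraD a c : M a -> M c -> M (a + c).
Proof. by move=> Ma Mc; rewrite -[a]scale1r; exact: star_subalgebraP. Qed.

Lemma star_subalgebraZ (k : R[i]) a : M a -> M (k *: a).
Proof.
by move=> Ma; rewrite -[k *: a]addr0; exact: star_subalgebraP star_subalgebra0.
Qed.

Lemma star_subalgebraN a : M a -> M (- a).
Proof. by move=> Ma; rewrite -scaleN1r; exact: star_subalgebraZ. Qed.

Lemma star_subalgebraM a c : M a -> M c -> M (a \o c).
Proof. by case: hM => _ _ _ h _; exact: h. Qed.

End StarSubalgebra.

(** The elements of M, bundled so that they form an algebra over R: real scalars
    suffice, since only real parts of traces matter.  The two proofs are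
    parameters because the ring structure depends on closure of M and on 1 <> 0.
    *)
Definition elt (R : realType) (H : completeNormedModType R[i])
    (form : {dot H for Num.conj}) (M : set (H -> H))
    (hM : star_subalgebra form M) (nz : (id : H -> H) <> 0) : Type :=
  {a : H -> H | M a}.

Section EltRing.
Context (R : realType) (H : completeNormedModType R[i]).
Context (form : {dot H for Num.conj}) (M : set (H -> H)).
Context (hM : star_subalgebra form M) (nz : (id : H -> H) <> 0).

Local Notation E := (elt hM nz).

HB.instance Definition _ := gen_eqMixin E.
HB.instance Definition _ := gen_choiceMixin E.

Definition op (a : E) : H -> H := sval a.

Lemma opP (a : E) : M (op a).
Proof. exact: (svalP a). Qed.

Lemma op_inj (a b : E) : op a = op b -> a = b.
Proof. by case: a b => [a Ma] [b Mb] /=; exact: eq_exist. Qed.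

Lemma elt_eq (a b : E) : (forall x, op a x = op b x) -> a = b.
Proof. by move=> ab; apply: op_inj; exact/funext. Qed.

Lemma op_is_linear (a : E) (k : R[i]) x y :
  op a (k *: x + y) = k *: op a x + op a y.
Proof. exact: (star_subalgebra_linear hM (opP a)). Qed.

Lemma opDr (a : E) x y : op a (x + y) = op a x + op a y.
Proof. by have := op_is_linear a 1 x y; rewrite !scale1r. Qed.

Lemma opr0 (a : E) : op a 0 = 0.
Proof. by apply: (@addrI _ (op a 0)); rewrite -opDr !addr0. Qed.

Lemma opZr (a : E) (k : R[i]) x : op a (k *: x) = k *: op a x.
Proof. by have := op_is_linear a k x 0; rewrite opr0 !addr0. Qed.

Definition elt0 : E := exist _ 0 (star_subalgebra0 hM).
Definition elt1 : E := exist _ id (star_subalgebra1 hM).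
Definition eltN (a : E) : E := exist _ (- op a) (star_subalgebraN hM (opP a)).
Definition eltD (a b : E) : E :=
  exist _ (op a + op b) (star_subalgebraD hM (opP a) (opP b)).
Definition eltM (a b : E) : E :=
  exist _ (op a \o op b) (star_subalgebraM hM (opP a) (opP b)).
Definition eltZ (k : R) (a : E) : E :=
  exist _ (k%:C *: op a) (star_subalgebraZ hM k%:C (opP a)).

Program Definition elt_isZmodule :=
  @GRing.isZmodule.Build E elt0 eltN eltD _ _ _ _.
Next Obligation. by move=> a b c; apply: op_inj; exact: addrA. Qed.
Next Obligation. by move=> a b; apply: op_inj; exact: addrC. Qed.
Next Obligation. by move=> a; apply: op_inj; exact: add0r. Qed.
Next Obligation. by move=> a; apply: op_inj; exact: addNr. Qed.
HB.instance Definition _ := elt_isZmodule.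

Program Definition elt_isNzRing :=
  @GRing.Zmodule_isNzRing.Build E elt1 eltM _ _ _ _ _ _.
Next Obligation. by move=> a b c; exact: op_inj. Qed.
Next Obligation. by move=> a; exact: op_inj. Qed.
Next Obligation. by move=> a; exact: op_inj. Qed.
Next Obligation. by move=> a b c; exact: op_inj. Qed.
Next Obligation. by move=> a b c; apply: elt_eq => x; exact: opDr. Qed.
Next Obligation. by apply/eqP => /(congr1 op)/nz. Qed.
HB.instance Definition _ := elt_isNzRing.

Program Definition elt_isLmodule :=
  @GRing.Zmodule_isLmodule.Build R E eltZ _ _ _ _.
Next Obligation.
by move=> k l a; apply: op_inj; rewrite /= scalerA rmorphM.
Qed.
Next Obligation. by move=> a; apply: op_inj; exact: scale1r. Qed.
Next Obligation. by move=> k a b; apply: op_inj; exact: scalerDr. Qed.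
Next Obligation.
by move=> a k l; apply: op_inj; rewrite /= rmorphD; exact: scalerDl.
Qed.
HB.instance Definition _ := elt_isLmodule.

Lemma elt_scalerAl (k : R) (a b : E) : k *: (a * b) = k *: a * b.
Proof. exact: op_inj. Qed.
HB.instance Definition _ := GRing.Lmodule_isLalgebra.Build R E elt_scalerAl.

Lemma elt_scalerAr (k : R) (a b : E) : k *: (a * b) = a * (k *: b).
Proof. by apply: elt_eq => x; rewrite /= opZr. Qed.
HB.instance Definition _ := GRing.Lalgebra_isAlgebra.Build R E elt_scalerAr.

End EltRing.

(** * Estimates in the Hilbert space *)

Lemma idem_compl (A : nzRingType) (q : A) :
  q * q = q -> (1 - q) * (1 - q) = 1 - q.
Proof. by move=> qq; rewrite mulrBr mulr1 mulrBl mul1r qq subrr subr0. Qed.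

Section HilbertSpace.
Context (R : realType) (H : completeNormedModType R[i]).
Context (form : {dot H for Num.conj}).
Context (hH : hilbert form).

(** The norm takes values in R[i]; its real part carries the same information and
    lets estimates be made in the ordered field R. *)
Definition nrm (x : H) : R := complex.Re `|x|.

Lemma nrmE x : `|x| = (nrm x)%:C.
Proof. by rewrite /nrm RRe_real// ger0_real. Qed.

Lemma nrm_ge0 x : 0 <= nrm x.
Proof. by rewrite -ler0c -nrmE. Qed.

Lemma ler_nrmD x y : nrm (x + y) <= nrm x + nrm y.
Proof. by rewrite -lecR rmorphD /= -!nrmE ler_normD. Qed.

Lemma nrmN x : nrm (- x) = nrm x.
Proof. by rewrite /nrm normrN. Qed.

Lemma nrm0_eq0 x : nrm x = 0 -> x = 0.
Proof. by move=> x0; apply/eqP; rewrite -normr_eq0 nrmE x0. Qed.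

Lemma nrmZ (r : R) x : nrm (r%:C *: x) = `|r| * nrm x.
Proof.
apply: complexI; rewrite -nrmE normrZ nrmE rmorphM; congr (_ * _).
by rewrite normc_def /= expr0n addr0 sqrtr_sqr.
Qed.

Lemma ip_diag x : form x x = (nrm x ^+ 2)%:C.
Proof. by rewrite -hH nrmE rmorphXn. Qed.

Lemma ipC x y : form x y = Num.conj (form y x).
Proof. by rewrite hermC expr0 mul1r. Qed.

Lemma ipZl (k : R[i]) x y : form (k *: x) y = k * form x y.
Proof. by rewrite linearZl_LR. Qed.

Lemma ipZr (k : R[i]) x y : form x (k *: y) = Num.conj k * form x y.
Proof. by rewrite linearZr_LR. Qed.

Lemma ipDl x y z : form (x + y) z = form x z + form y z.
Proof. exact: linearDl. Qed.

Lemma ipDr x y z : form x (y + z) = form x y + form x z.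
Proof. exact: linearDr. Qed.

Lemma ipNl x y : form (- x) y = - form x y.
Proof. exact: linearNl. Qed.

Lemma ipNr x y : form x (- y) = - form x y.
Proof. exact: linearNr. Qed.

Lemma ipBl x y z : form (x - y) z = form x z - form y z.
Proof. exact: linearBl. Qed.

(** Positivity of the form at x - k y, for the k that makes this vector
    orthogonal to y. *)
Lemma CauchySchwarz_form x y : `|form x y| <= (nrm x * nrm y)%:C.
Proof.
have [->|y0] := eqVneq y 0.
  by rewrite linear0r normr0 ler0c mulr_ge0 ?nrm_ge0.
have fy : 0 < form y y by rewrite dnorm_gt0.
have fyJ : Num.conj (form y y) = form y y by rewrite -ipC.
set k := form x y / form y y.
have kJ : Num.conj k = Num.conj (form x y) / form y y
  by rewrite rmorphM /= fmorphV /= fyJ.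
have : 0 <= form (x - k *: y) (x - k *: y) by rewrite dnorm_ge0.
have -> : form (x - k *: y) (x - k *: y)
    = form x x - `|form x y| ^+ 2 / form y y.
  rewrite ipBl !ipDr !ipNr !ipZl !ipZr kJ (ipC y x) normCK /k.
  field; exact: lt0r_neq0.
rewrite subr_ge0 ler_pdivrMr// !ip_diag -rmorphM -exprMn rmorphXn.
by rewrite ler_pXn2r// nnegrE ?ler0c ?mulr_ge0 ?nrm_ge0.
Qed.

Lemma ler_Re_form x y : complex.Re (form x y) <= nrm x * nrm y.
Proof.
rewrite -lecR; apply: le_trans (CauchySchwarz_form x y).
by apply: le_trans (normc_ge_Re _); rewrite lecR ler_norm.
Qed.

End HilbertSpace.

(** * Adjoints, positivity and norm bounds *)

Section Positivity.
Context (R : realType) (H : completeNormedModType R[i]).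
Context (form : {dot H for Num.conj}) (M : set (H -> H)).
Context (hM : star_subalgebra form M) (nz : (id : H -> H) <> 0).
Context (hH : hilbert form).

Local Notation E := (elt hM nz).

Implicit Types (a b c d q : E) (x y : H).

Lemma opDl a b x : op (a + b) x = op a x + op b x.
Proof. by []. Qed.

Lemma opNl a x : op (- a) x = - op a x.
Proof. by []. Qed.

Lemma opBl a b x : op (a - b) x = op a x - op b x.
Proof. by []. Qed.

Lemma opZl (k : R) a x : op (k *: a) x = k%:C *: op a x.
Proof. by []. Qed.

Lemma opM a b x : op (a * b) x = op a (op b x).
Proof. by []. Qed.

(** A relation instead of an operation: every adjoint below is explicit, so that
    none has to be chosen. *)
Definition adj a b := is_adjoint form (op a) (op b).

Definition pos a := op_ge0 form (op a).

Lemma adj_sym a b : adj a b -> adj b a.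
Proof. by move=> ab x y; rewrite ipC -ab -ipC. Qed.

Lemma adj1 : adj 1 1.
Proof. by []. Qed.

Lemma adjD a b c d : adj a b -> adj c d -> adj (a + c) (b + d).
Proof. by move=> ab cd x y; rewrite !opDl ipDl ipDr ab cd. Qed.

Lemma adjN a b : adj a b -> adj (- a) (- b).
Proof. by move=> ab x y; rewrite !opNl ipNl ipNr ab. Qed.

Lemma adjB a b c d : adj a b -> adj c d -> adj (a - c) (b - d).
Proof. by move=> ab cd; apply: adjD => //; exact: adjN. Qed.

Lemma adjZ (k : R) a b : adj a b -> adj (k *: a) (k *: b).
Proof.
move=> ab x y; rewrite !opZl ipZl ipZr ab; congr (_ * _).
by rewrite -[RHS]/((k%:C)^*%C) conjc_real.
Qed.

Lemma adjM a b c d : adj a b -> adj c d -> adj (a * c) (d * b).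
Proof. by move=> ab cd x y; rewrite !opM ab cd. Qed.

Lemma adjA (k : R) : adj k%:A k%:A.
Proof. exact: adjZ adj1. Qed.

(** Polarization: a quadratic form that is real everywhere comes from a
    self-adjoint operator over the complex field; the vectors x + y and i x + y
    give the imaginary and the real part of the identity. *)
Lemma pos_adj a : pos a -> adj a a.
Proof.
move=> a0.
have real x : complex.Im (form (op a x) x) = 0 by rewrite ger0_Im.
have sym x y : complex.Im (form (op a x) y + form (op a y) x) = 0.
  have := real (x + y); rewrite opDr !ipDl !ipDr.
  move: (real x) (real y).
  case: (form (op a x) x) => ? ?; case: (form (op a x) y) => ? ?.
  case: (form (op a y) x) => ? ?; case: (form (op a y) y) => ? ? /=.
  by move=> -> ->; rewrite add0r addr0.
move=> x y; rewrite (ipC _ x).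
have := sym x y; have := sym ('i *: x) y.
rewrite opZr ipZl ipZr.
case: (form (op a x) y) => p q; case: (form (op a y) x) => r s /=.
rewrite !(mul0r, mul1r, mulr0, add0r, subr0, addr0, mulN1r) => h1 h2.
rewrite -[RHS]/(r -i* s); apply/eqP; rewrite eq_complex /=.
by apply/andP; split; apply/eqP; lra.
Qed.

Lemma pos_of_Re a : adj a a -> (forall x, 0 <= complex.Re (form (op a x) x)) ->
  pos a.
Proof.
move=> aa h x; rewrite lecE /= h andbT; apply/eqP.
have := ipC form (op a x) x; rewrite -aa; case: (form _ _) => p q [] /= hq.
by lra.
Qed.

Lemma Re_ge0_of_pos a x : pos a -> 0 <= complex.Re (form (op a x) x).
Proof. by move=> /(_ x); rewrite lecE => /andP[]. Qed.

Lemma posD a b : pos a -> pos b -> pos (a + b).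
Proof. by move=> pa pb x; rewrite opDl ipDl addr_ge0. Qed.

Lemma posZ (k : R) a : 0 <= k -> pos a -> pos (k *: a).
Proof. by move=> k0 pa x; rewrite opZl ipZl mulr_ge0 ?ler0c. Qed.

Lemma pos1 : pos 1.
Proof. by move=> x; rewrite dnorm_ge0. Qed.

Lemma pos_conj a b c : adj b c -> pos a -> pos (c * a * b).
Proof. by move=> bc pa x; rewrite !opM (adj_sym bc). Qed.

Lemma pos_sqr b c : adj b c -> pos (c * b).
Proof. by move=> bc; rewrite -(mulr1 c); exact: pos_conj pos1. Qed.

Lemma pos_idem q : adj q q -> q * q = q -> pos q.
Proof. by move=> aq qq; rewrite -qq; exact: pos_sqr. Qed.

Lemma eq0_of_sqr_le0 b c : adj b c -> pos (- (c * b)) -> b = 0.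
Proof.
move=> bc /= p; apply: elt_eq => x; apply/eqP.
rewrite -(dnorm_eq0 form) eq_le dnorm_ge0 andbT.
by have := p x; rewrite opNl opM ipNl (adj_sym bc) oppr_ge0.
Qed.

(** The sum a (1 - a) a + (1 - a) a (1 - a) of two positive elements equals
    a - a^2.  It replaces the square root of a in bounding a and in deducing
    a x = 0 from <a x, x> = 0. *)
Lemma pos_unit_sub_sqr a : pos a -> pos (1 - a) -> pos (a - a * a).
Proof.
move=> pa pa'; have aa := pos_adj pa.
have -> : a - a * a = a * (1 - a) * a + (1 - a) * a * (1 - a).
  have comm : (1 - a) * a = a * (1 - a) by rewrite mulrBl mulrBr mul1r mulr1.
  by rewrite comm -mulrDr [a + (1 - a)]addrC subrK mulr1 mulrBr mulr1.
by apply: posD; apply: pos_conj => //; apply: adjB.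
Qed.

Definition bnd a (k : R) := forall x, nrm (op a x) <= k * nrm x.

Lemma bnd_ex a : exists2 k : R, 0 <= k & bnd a k.
Proof.
case: (hM) => /(_ _ (opP a))[_ [c hc]] _ _ _ _.
exists `|complex.Re c| => // x.
apply: (@le_trans _ _ (complex.Re c * nrm x)); last first.
  by rewrite ler_wpM2r ?nrm_ge0 ?ler_norm.
have := hc x; rewrite !nrmE lecE => /andP[_] /=.
by case: c {hc} => u v /=; rewrite mulr0 subr0.
Qed.

Lemma bndD a b (k l : R) : bnd a k -> bnd b l -> bnd (a + b) (k + l).
Proof.
by move=> ak bl x; rewrite (le_trans (ler_nrmD _ _))// mulrDl lerD.
Qed.

Lemma bndN a (k : R) : bnd a k -> bnd (- a) k.
Proof. by move=> ak x; rewrite opNl nrmN. Qed.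

Lemma bndB a b (k l : R) : bnd a k -> bnd b l -> bnd (a - b) (k + l).
Proof. by move=> ak bl; exact: bndD ak (bndN bl). Qed.

Lemma bndZ (r : R) a (k : R) : bnd a k -> bnd (r *: a) (`|r| * k).
Proof. by move=> ak x; rewrite opZl nrmZ -mulrA ler_wpM2l. Qed.

Lemma bndM a b (k l : R) : 0 <= k -> bnd a k -> bnd b l -> bnd (a * b) (k * l).
Proof.
by move=> k0 ak bl x; rewrite opM (le_trans (ak _))// -mulrA ler_wpM2l.
Qed.

Lemma bnd1 : bnd 1 1.
Proof. by move=> x; rewrite mul1r. Qed.

Lemma bnd_le a (k l : R) : k <= l -> bnd a k -> bnd a l.
Proof. by move=> kl ak x; rewrite (le_trans (ak x))// ler_wpM2r ?nrm_ge0. Qed.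

Lemma bnd_eq0 a : (forall e : R, 0 < e -> bnd a e) -> a = 0.
Proof.
move=> h; apply: elt_eq => x; apply: nrm0_eq0; apply/eqP.
rewrite eq_le nrm_ge0 andbT; apply/ler_addgt0Pr => e e0; rewrite add0r.
have n1 : 0 < nrm x + 1 by rewrite ltr_wpDl ?nrm_ge0.
rewrite (le_trans (h (e / (nrm x + 1)) _ x)) ?divr_gt0//.
by rewrite mulrAC ler_pdivrMr// ler_pM2l// lerDl.
Qed.

Lemma pos_of_bnd a (k : R) : adj a a -> bnd a k -> pos (k%:A - a).
Proof.
move=> aa ak; apply: pos_of_Re; first exact: adjB (adjA _) aa.
move=> x; rewrite opBl opZl ipBl ipZl (ip_diag hH) -rmorphM raddfB /= subr_ge0.
rewrite (le_trans (ler_Re_form hH _ _))// expr2 mulrA.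
by rewrite ler_wpM2r ?nrm_ge0.
Qed.

(** |a x|^2 = <a^2 x, x> <= <a x, x> <= |x|^2, as a - a^2 and 1 - a are
    positive. *)
Lemma bnd_of_pos a : pos a -> pos (1 - a) -> bnd a 1.
Proof.
move=> pa pa' x; rewrite mul1r -(@ler_pXn2r _ 2%N) ?nnegrE ?nrm_ge0//.
have aa := pos_adj pa.
have := Re_ge0_of_pos x (posD (pos_unit_sub_sqr pa pa') pa').
rewrite addrC addrA subrK opBl opM ipBl aa !(ip_diag hH) raddfB /=.
by rewrite subr_ge0.
Qed.

End Positivity.

(** * Norm limits in M *)

Section Limits.
Context (R : realType) (H : completeNormedModType R[i]).
Context (form : {dot H for Num.conj}) (M : set (H -> H)).
Context (hM : star_subalgebra form M) (nz : (id : H -> H) <> 0).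
Context (hH : hilbert form).
Context (hwot : wot_closed form M).

Local Notation E := (elt hM nz).

Definition norm_cvg (X : nat -> E) (Y : E) : Prop :=
  forall e : R, 0 < e -> exists N, forall n, (N <= n)%N -> bnd (Y - X n) e.

(** The real sequence x converges, so X is Cauchy in operator norm with explicit
    rate lim x - x n.  Its pointwise limit is then a bounded operator, at distance
    at most that rate from X n, and the Cauchy-Schwarz inequality makes the
    convergence weak, so that the limit lies in M. *)
Lemma norm_cvg_ex (X : nat -> E) (x : nat -> R) (l : R) :
  nondecreasing_seq x -> (forall n, x n <= l) ->
  (forall n, bnd (X n.+1 - X n) (x n.+1 - x n)) -> exists Y, norm_cvg X Y.
Proof.
move=> x_nd x_le Xx.
have x_cvg : cvgn x.
  by apply: nondecreasing_is_cvgn => //; exists l => _ [n _ <-].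
pose L := limn x.
have xL n : x n <= L by exact: nondecreasing_cvgn_le.
have small (e : R) : 0 < e -> exists N, forall n, (N <= n)%N -> L - x n < e.
  move=> e0; have /cvgrPdist_lt/(_ _ e0)[N _ hN] := x_cvg.
  by exists N => n /hN; rewrite ger0_norm// subr_ge0.
have dist n m : (n <= m)%N -> bnd (X m - X n) (x m - x n).
  move=> /subnKC <-; elim: (m - n)%N => [|k IH].
    by move=> z; rewrite addn0 !subrr mul0r /nrm normr0.
  rewrite addnS -(subrKA (X (n + k)%N)) -(subrKA (x (n + k)%N)).
  exact: bndD.
have distL n m z : (n <= m)%N ->
    nrm (op (X m) z - op (X n) z) <= (L - x n) * nrm z.
  move=> nm; rewrite -opBl (le_trans (dist _ _ nm z))//.
  by rewrite ler_wpM2r ?nrm_ge0// lerB.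
have X_cvg z : cvg (op (X n) z @[n --> \oo]).
  apply: cauchy_cvg; apply: cauchy_exP => e e0.
  have z1 : 0 < nrm z + 1 by rewrite ltr_wpDl ?nrm_ge0.
  have eE : e = (complex.Re e)%:C by rewrite RRe_real// gtr0_real.
  have re0 : 0 < complex.Re e by rewrite -ltcR -eE.
  have [N hN] := small (complex.Re e / (nrm z + 1)) (divr_gt0 re0 z1).
  exists (op (X N) z); exists N => // n /= Nn.
  rewrite -ball_normE /ball_ /= eE -normrN opprB nrmE ltcR.
  rewrite (le_lt_trans (distL _ _ z Nn))//.
  apply: (@le_lt_trans _ _ ((L - x N) * (nrm z + 1))).
    by rewrite ler_wpM2l ?subr_ge0// lerDl.
  by rewrite -ltr_pdivlMr// hN.
pose Y z := lim (op (X n) z @[n --> \oo]).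
have distY n z : nrm (Y z - op (X n) z) <= (L - x n) * nrm z.
  apply/ler_addgt0Pr => e e0.
  have e0' : 0 < e%:C :> R[i] by rewrite ltcR.
  have /cvgrPdist_lt/(_ _ e0')[N _ hN] := X_cvg z.
  have := hN (maxn N n) (leq_maxl _ _); rewrite nrmE ltcR => /ltW h1.
  have h2 := distL n (maxn N n) z (leq_maxr _ _).
  (* An index beyond both N and n, close to the limit and controlled from n. *)
  rewrite -(subrKA (op (X (maxn N n)) z)).
  by rewrite (le_trans (ler_nrmD _ _))// [leRHS]addrC lerD.
have Y_lin : linear Y.
  move=> k u v; apply: cvg_lim; first exact: norm_hausdorff.
  have -> : (fun n => op (X n) (k *: u + v)) =
      (fun n => k *: op (X n) u + op (X n) v).
    by apply/funext => n; rewrite op_is_linear.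
  by apply: cvgD; [apply: cvgZr; exact: X_cvg | exact: X_cvg].
have Y_bounded : bounded_op Y.
  split => //; have [k k0 hk] := bnd_ex (X 0%N).
  exists (L - x 0%N + k)%:C => z; rewrite !nrmE -rmorphM lecR mulrDl.
  rewrite -(subrK (op (X 0%N) z) (Y z)) (le_trans (ler_nrmD _ _))// lerD//.
have MY : M Y.
  apply: (hwot (F := op (X n) @[n --> \oo])) => //.
    by exists 0%N => // n _; exact: opP.
  move=> u v; apply/cvgrPdist_lt => e e0.
  have c0 : 0 < nrm u * nrm v + 1 by rewrite ltr_wpDl// mulr_ge0 ?nrm_ge0.
  have eE : e = (complex.Re e)%:C by rewrite RRe_real// gtr0_real.
  have re0 : 0 < complex.Re e by rewrite -ltcR -eE.
  have [N hN] := small _ (divr_gt0 re0 c0).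
  exists N => // n /= Nn; rewrite -ipBl.
  rewrite (le_lt_trans (CauchySchwarz_form hH _ _))// eE ltcR.
  apply: (@le_lt_trans _ _ ((L - x n) * (nrm u * nrm v + 1))).
    rewrite (@le_trans _ _ ((L - x n) * nrm u * nrm v))//.
      by rewrite ler_wpM2r ?nrm_ge0 ?distY.
    by rewrite -mulrA ler_wpM2l ?subr_ge0// lerDl.
  by rewrite -ltr_pdivlMr// hN.
exists (exist _ Y MY : E) => e e0; have [N hN] := small _ e0.
exists N => n /hN /ltW h z; rewrite (le_trans (distY n z))//.
by rewrite ler_wpM2r ?nrm_ge0.
Qed.

End Limits.

(** * Square roots and inverses in M *)

Section FunctionalCalculus.
Context (R : realType) (H : completeNormedModType R[i]).
Context (form : {dot H for Num.conj}) (M : set (H -> H)).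
Context (hM : star_subalgebra form M) (nz : (id : H -> H) <> 0).
Context (hH : hilbert form).
Context (hwot : wot_closed form M).

Local Notation E := (elt hM nz).

Implicit Types (a b D K T Y Z : E) (X : nat -> E).

Lemma norm_cvg_bnd X Y (k : R) : norm_cvg X Y -> (forall n, bnd (X n) k) -> bnd Y k.
Proof.
move=> XY Xk z; apply/ler_addgt0Pr => e e0.
have z1 : 0 < nrm z + 1 by rewrite ltr_wpDl ?nrm_ge0.
have [N /(_ N (leqnn N)) hN] := XY _ (divr_gt0 e0 z1).
have := bndD hN (Xk N); rewrite subrK => /(_ z)/le_trans; apply.
rewrite mulrDl addrC lerD2l mulrAC ler_pdivrMr// ler_pM2l// lerDl//.
Qed.

Lemma norm_cvg_adj X Y : norm_cvg X Y -> (forall n, adj (X n) (X n)) -> adj Y Y.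
Proof.
move=> XY Xa z w; apply/eqP; rewrite -subr_eq0 -normr_le0.
set d := _ - _; rewrite -[`|d|]RRe_real ?ger0_real// lecR.
apply/ler_addgt0Pr => e e0; rewrite add0r.
set k := nrm z * nrm w.
have k0 : 0 <= k by rewrite mulr_ge0 ?nrm_ge0.
have k1 : 0 < 2 * (k + 1) by rewrite mulr_gt0// ltr_wpDl.
have [N /(_ N (leqnn N)) hN] := XY _ (divr_gt0 e0 k1).
have -> : d = form (op (Y - X N) z) w - form z (op (Y - X N) w).
  by rewrite /d !opBl ipBl ipDr ipNr Xa opprB addrA subrK.
rewrite -lecR RRe_real ?ger0_real//.
apply: le_trans (ler_normB _ _) _.
apply: le_trans (lerD (CauchySchwarz_form hH _ _) (CauchySchwarz_form hH _ _)) _.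
rewrite -rmorphD lecR.
apply: (@le_trans _ _ (e / (2 * (k + 1)) * k + e / (2 * (k + 1)) * k)).
  apply: lerD; first by rewrite /k mulrA ler_wpM2r ?nrm_ge0.
  by rewrite /k mulrCA ler_wpM2l ?nrm_ge0.
rewrite -mulrDr mulrAC ler_pdivrMr// ler_pM2l// mulrDr mulr1.
by rewrite mulr_natl mulr2n lerDl.
Qed.

Lemma norm_cvg_comm X Y D : norm_cvg X Y -> (forall n, X n * D = D * X n) ->
  Y * D = D * Y.
Proof.
move=> XY XD; apply/eqP; rewrite -subr_eq0; apply/eqP; apply: bnd_eq0 => e e0.
have [k k0 hk] := bnd_ex D.
have k1 : 0 < 2 * (k + 1) by rewrite mulr_gt0// ltr_wpDl.
have [N /(_ N (leqnn N)) hN] := XY _ (divr_gt0 e0 k1).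
have -> : Y * D - D * Y = (Y - X N) * D - D * (Y - X N).
  by rewrite mulrBl mulrBr XD opprB addrA subrK.
have e1 : 0 <= e / (2 * (k + 1)) by rewrite divr_ge0// ltW.
apply: bnd_le (bndB (bndM e1 hN hk) (bndM k0 hk hN)).
rewrite [k * _]mulrC -mulrDr mulrAC ler_pdivrMr// ler_pM2l// mulrDr mulr1.
by rewrite mulr_natl mulr2n lerDl.
Qed.

Lemma sqr_sub_sqr a b : a * a - b * b = a * (a - b) + (a - b) * b.
Proof. by rewrite mulrBr mulrBl addrA subrK. Qed.

(** If Y = (K + Y^2) / 2 then (1 - Y)^2 = 1 - K: iterating this fixed point
    equation computes the square root 1 - Y of 1 - K.  The scalar iteration
    [sqrt_bnd] is the case K = 1; since the iterates are polynomials in K with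
    nonnegative coefficients, it dominates the iteration of any contraction. *)
Fixpoint sqrt_iter K n : E :=
  if n is m.+1 then 2^-1 *: (K + sqrt_iter K m * sqrt_iter K m) else 0.

Fixpoint sqrt_bnd n : R :=
  if n is m.+1 then 2^-1 * (1 + sqrt_bnd m * sqrt_bnd m) else 0.

Lemma sqrt_bnd_itv n : 0 <= sqrt_bnd n <= 1.
Proof. by elim: n => [|n /andP[h0 h1]] /=; [rewrite lexx ler01 | nra]. Qed.

Lemma sqrt_bnd_nd : nondecreasing_seq sqrt_bnd.
Proof.
apply/nondecreasing_seqP => n /=; have := sqr_ge0 (1 - sqrt_bnd n).
have /andP[] := sqrt_bnd_itv n; nra.
Qed.

Lemma bnd_sqrt_iter K n : bnd K 1 -> bnd (sqrt_iter K n) (sqrt_bnd n).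
Proof.
move=> hK; elim: n => [|n IH] /=.
  by move=> z; rewrite mul0r /nrm normr0.
have /andP[x0 _] := sqrt_bnd_itv n.
rewrite -[in X in bnd _ X](@ger0_norm _ (2^-1 : R))//.
exact/bndZ/bndD/bndM.
Qed.

(** Induction, factoring the difference of two squares X'^2 - X^2 as
    X' (X' - X) + (X' - X) X: the same identity for scalars makes the bounds match
    exactly. *)
Lemma bnd_sqrt_iterS K n : bnd K 1 ->
  bnd (sqrt_iter K n.+1 - sqrt_iter K n) (sqrt_bnd n.+1 - sqrt_bnd n).
Proof.
move=> hK; elim: n => [|n IH].
  rewrite /= !mulr0 !addr0 !subr0 -[in X in bnd _ X](@ger0_norm _ (2^-1 : R))//.
  exact: bndZ.
set X := sqrt_iter K n in IH *; set X' := sqrt_iter K n.+1 in IH *.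
have -> : sqrt_iter K n.+2 - X' = 2^-1 *: (X' * (X' - X) + (X' - X) * X).
  by rewrite -sqr_sub_sqr /= -scalerBr opprD addrACA subrr add0r.
set x := sqrt_bnd n in IH *; set x' := sqrt_bnd n.+1 in IH *.
have -> : sqrt_bnd n.+2 - x' = `|2^-1| * (x' * (x' - x) + (x' - x) * x).
  transitivity (2^-1 * (1 + x' * x') - 2^-1 * (1 + x * x)) => //.
  by rewrite ger0_norm//; ring.
have x'0 : 0 <= x' by have /andP[] := sqrt_bnd_itv n.+1.
have xx' : 0 <= x' - x by rewrite subr_ge0; exact: sqrt_bnd_nd.
apply/bndZ/bndD; apply: bndM => //; exact: bnd_sqrt_iter.
Qed.

Lemma sqrt_one_sub_ex K : adj K K -> bnd K 1 -> exists Y,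
  [/\ adj Y Y, bnd Y 1, (1 - Y) * (1 - Y) = 1 - K
    & forall D, K * D = D * K -> Y * D = D * Y].
Proof.
move=> aK bK.
have iter1 n : bnd (sqrt_iter K n) 1.
  by apply: bnd_le (bnd_sqrt_iter n bK); have /andP[] := sqrt_bnd_itv n.
have [Y XY] : exists Y, norm_cvg (sqrt_iter K) Y.
  apply: (norm_cvg_ex hH hwot sqrt_bnd_nd (l := 1)) => n.
    by have /andP[] := sqrt_bnd_itv n.
  exact: bnd_sqrt_iterS.
have Y1 : bnd Y 1 := norm_cvg_bnd XY iter1.
(* The fixed point equation passes to the limit in norm; the defect of Y is a
   combination of Y - X n.+1 and Y - X n, of total norm at most 2 (e / 2). *)
have YE : Y = 2^-1 *: (K + Y * Y).
  apply/eqP; rewrite -subr_eq0; apply/eqP; apply: bnd_eq0 => e e0.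
  have [N hN] := XY _ (divr_gt0 e0 (ltr0n _ 2)).
  have hY := hN _ (leqnn N); have hY' := hN _ (leqnSn N).
  set X := sqrt_iter K N in hY.
  have -> : Y - 2^-1 *: (K + Y * Y) =
      Y - sqrt_iter K N.+1 - 2^-1 *: (Y * (Y - X) + (Y - X) * X).
    rewrite -sqr_sub_sqr /= -/X -addrA -opprD -scalerDr.
    by rewrite -[in RHS]addrA [X * X + _]addrC subrK.
  have -> : e = e / 2 + `|2^-1| * (1 * (e / 2) + e / 2 * 1).
    by rewrite ger0_norm//; field.
  have e2 : 0 <= e / 2 by rewrite divr_ge0// ltW.
  by apply: bndB => //; apply/bndZ/bndD; apply: bndM => //; exact: iter1.
exists Y; split => //.
- apply: (norm_cvg_adj XY); elim=> [|n IH] /=.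
    by move=> z w; rewrite (linear0l form) (linear0r form).
  by apply/adjZ/adjD => //; exact: adjM.
- have Y2 : Y + Y = K + Y * Y.
    have half : 2^-1 + 2^-1 = 1 :> R by field.
    by rewrite {1 2}YE -scalerDl half scale1r.
  have KE : K = Y + (Y - Y * Y) by rewrite addrA Y2 addrK.
  by rewrite [in RHS]KE opprD addrA mulrBl mul1r mulrBr mulr1.
- move=> D KD; apply: (norm_cvg_comm XY); elim=> [|n IH] /=.
    by rewrite mul0r mulr0.
  rewrite -scalerAl -scalerAr mulrDl mulrDr KD.
  by rewrite -mulrA IH mulrA IH -mulrA.
Qed.

(** A multiple of the absolute value of D: with c a norm bound of D, the element
    K = 1 - D^2 / c^2 lies between 0 and 1, and c times the square root of 1 - K
    is as wanted.  It commutes with D as a limit of polynomials in D^2. *)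
Lemma sqrt_ex D : adj D D ->
  exists A, [/\ pos A, A * A = D * D & A * D = D * A].
Proof.
move=> aD; have [k k0 hk] := bnd_ex D.
pose c := k + 1; have c0 : 0 < c by rewrite ltr_wpDl.
have hc : bnd D c by apply: bnd_le hk; rewrite lerDl.
pose K := 1 - (c ^- 2) *: (D * D).
have aK : adj K K by apply: (adjB (@adj1 _ _ _ _ _ _)); apply/adjZ/adjM.
have c2 : 0 <= c ^- 2 by rewrite invr_ge0 exprn_ge0// ltW.
have pK' : pos (1 - K) by rewrite subKr; apply/posZ/pos_sqr.
have pK : pos K.
  have -> : K = c ^- 2 *: ((c ^+ 2)%:A - D * D).
    by rewrite scalerBr scalerA mulVf ?scale1r// expf_neq0// lt0r_neq0.
  apply/posZ/(pos_of_bnd hH) => //; first exact: adjM.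
  by rewrite expr2; apply: bndM => //; exact: ltW.
have [Y [aY Y1 YK YD]] := sqrt_one_sub_ex aK (bnd_of_pos hH pK pK').
exists (c *: (1 - Y)); split.
- by apply: (posZ (ltW c0)); rewrite -[1]scale1r; exact: pos_of_bnd.
- rewrite -scalerAl -scalerAr scalerA YK subKr scalerA -expr2.
  by rewrite mulfV ?scale1r// expf_neq0// lt0r_neq0.
- rewrite -scalerAl -scalerAr; congr (_ *: _).
  rewrite mulrBl mulrBr mul1r mulr1 YD//.
  by rewrite mulrBl mulrBr mul1r mulr1 -scalerAl -scalerAr mulrA.
Qed.

(** Partial sums of the geometric series of T, in Horner form. *)
Fixpoint neumann_iter T n : E :=
  if n is m.+1 then 1 + T * neumann_iter T m else 0.

Fixpoint neumann_bnd (r : R) n : R :=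
  if n is m.+1 then 1 + r * neumann_bnd r m else 0.

Lemma one_sub_inv_ex T (r : R) : 0 <= r < 1 -> bnd T r ->
  exists W, (1 - T) * W = 1 /\ W * (1 - T) = 1.
Proof.
move=> /andP[r0 r1] hT.
have x0 n : 0 <= neumann_bnd r n.
  by elim: n => //= n IH; rewrite addr_ge0// mulr_ge0.
have x_inc n : 0 <= neumann_bnd r n.+1 - neumann_bnd r n.
  elim: n => [|n IH] /=; first by rewrite mulr0 addr0 subr0 ler01.
  by rewrite opprD addrACA subrr add0r -mulrBr mulr_ge0.
have [W XW] : exists W, norm_cvg (neumann_iter T) W.
  apply: (norm_cvg_ex hH hwot (x := neumann_bnd r) (l := (1 - r)^-1)).
  - by apply/nondecreasing_seqP => n; rewrite -subr_ge0.
  - have r1' : 0 < 1 - r by rewrite subr_gt0.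
    elim=> [|n IH] /=; first by rewrite invr_ge0 ltW.
    rewrite (@le_trans _ _ (1 + r * (1 - r)^-1))//.
      by rewrite lerD2l ler_wpM2l.
    by rewrite le_eqVlt; apply/orP; left; apply/eqP; field; exact: lt0r_neq0.
  elim=> [|n IH] /=.
    by rewrite !mulr0 !addr0 !subr0; exact: bnd1.
  rewrite opprD addrACA subrr add0r -mulrBr.
  by rewrite opprD addrACA subrr add0r -mulrBr; exact: bndM.
have WE : W = 1 + T * W.
  apply/eqP; rewrite -subr_eq0; apply/eqP; apply: bnd_eq0 => e e0.
  have [N hN] := XW _ (divr_gt0 e0 (ltr0n _ 2)).
  have hW := hN _ (leqnn N); have hW' := hN _ (leqnSn N).
  have -> : W - (1 + T * W) =
      W - neumann_iter T N.+1 - T * (W - neumann_iter T N).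
    by rewrite /= mulrBr opprB !opprD !addrA subrK.
  apply: bnd_le (bndB hW' (bndM r0 hT hW)); nra.
have TW : T * W = W * T.
  apply/esym/(norm_cvg_comm XW); elim=> [|n IH] /=; first by rewrite mul0r mulr0.
  by rewrite mulrDl mulrDr mul1r mulr1 -mulrA IH.
have h : (1 - T) * W = 1 by rewrite mulrBl mul1r {1}WE addrK.
by exists W; split=> //; rewrite -[RHS]h mulrBr mulrBl mul1r mulr1 TW.
Qed.

(** For c larger than d and than the norm of Z, the element T = 1 - Z / c satisfies
    0 <= T <= 1 - d / c, so its norm is less than 1 and 1 - T = Z / c is
    invertible. *)
Lemma inv_ex Z (d : R) : 0 < d -> pos (Z - d%:A) ->
  exists W, Z * W = 1 /\ W * Z = 1.
Proof.
move=> d0 pZ.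
have aZ : adj Z Z.
  by rewrite -(subrK d%:A Z); apply: (adjD _ (adjA _ _ _)); exact: pos_adj.
have [k k0 hk] := bnd_ex Z.
(* The summand d makes c > d, so that r is positive and T / r makes sense. *)
pose c := k + d + 1.
have c0 : 0 < c by rewrite ltr_wpDl// addr_ge0// ltW.
have hc : bnd Z c by apply: bnd_le hk; rewrite /c; lra.
pose r := 1 - d / c.
have dc : 0 < d / c by rewrite divr_gt0.
have r0 : 0 < r by rewrite subr_gt0 ltr_pdivrMr// /c; lra.
have r1 : r < 1 by rewrite /r; lra.
pose T := 1 - c^-1 *: Z.
have pT : pos T.
  have -> : T = c^-1 *: (c%:A - Z).
    by rewrite scalerBr scalerA mulVf ?scale1r// lt0r_neq0.
  by apply: posZ (pos_of_bnd hH aZ hc); rewrite invr_ge0 ltW.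
have pT' : pos (r%:A - T).
  have -> : r%:A - T = c^-1 *: (Z - d%:A).
    rewrite /T /r scalerBl scale1r opprB [LHS]addrC addrA subrK.
    by rewrite scalerBr scalerA [c^-1 * _]mulrC.
  by apply: posZ pZ; rewrite invr_ge0 ltW.
have hT : bnd T r.
  have ri : 0 <= r^-1 by rewrite invr_ge0 ltW.
  have hb : bnd (r^-1 *: T) 1.
    apply: (bnd_of_pos hH); first exact: posZ.
    have -> : 1 - r^-1 *: T = r^-1 *: (r%:A - T).
      by rewrite [RHS]scalerBr scalerA mulVf ?scale1r// lt0r_neq0.
    exact: posZ.
  have := bndZ r hb.
  by rewrite scalerA mulfV ?lt0r_neq0// scale1r mulr1 gtr0_norm.
have [W [TW WT]] := @one_sub_inv_ex T r (introT andP (conj (ltW r0) r1)) hT.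
have TE : 1 - T = c^-1 *: Z by rewrite subKr.
exists (c^-1 *: W); rewrite -scalerAr scalerAl -TE TW; split=> //.
by rewrite -scalerAl scalerAr -TE.
Qed.

End FunctionalCalculus.

(** * Testing positivity with a faithful trace *)

Section Trace.
Context (R : realType) (H : completeNormedModType R[i]).
Context (form : {dot H for Num.conj}) (M : set (H -> H)).
Context (hM : star_subalgebra form M) (nz : (id : H -> H) <> 0).
Context (tau : (H -> H) -> R[i]).
Context (hH : hilbert form).
Context (hwot : wot_closed form M).
Context (htau : tracial_state form M tau).
Context (hfaithful : faithful form M tau).

Local Notation E := (elt hM nz).

Implicit Types (a b c h k p q x y D Z : E).

Definition rho a : R := complex.Re (tau (op a)).

Lemma rhoD a b : rho (a + b) = rho a + rho b.
Proof.
case: htau => lin _ _ _; have := lin 1 _ _ (opP a) (opP b).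
by rewrite /rho scale1r mul1r => ->; rewrite raddfD.
Qed.

Lemma rho0 : rho 0 = 0.
Proof. by apply: (@addrI _ (rho 0)); rewrite -rhoD !addr0. Qed.

Lemma rhoZ (r : R) a : rho (r *: a) = r * rho a.
Proof.
case: htau => lin _ _ _; rewrite -[r *: a]addr0 rhoD rho0 addr0.
have := lin r%:C _ _ (opP a) (opP (0 : E)).
have := rho0; rewrite /rho => h0; rewrite -[_ + op 0]/(op (r *: a + 0)) addr0 => ->.
by rewrite raddfD /= h0 addr0; case: (tau _) => u v /=; rewrite mul0r subr0.
Qed.

Lemma rhoN a : rho (- a) = - rho a.
Proof. by rewrite -scaleN1r rhoZ mulN1r. Qed.

Lemma rhoB a b : rho (a - b) = rho a - rho b.
Proof. by rewrite rhoD rhoN. Qed.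

Lemma rhoC a b : rho (a * b) = rho (b * a).
Proof.
by case: htau => _ _ _ tr; rewrite /rho; congr complex.Re; exact: tr (opP a) (opP b).
Qed.

Lemma rho_ge0 a : pos a -> 0 <= rho a.
Proof.
by case: htau => _ + _ _ => /(_ _ (opP a)) h /h; rewrite lecE => /andP[].
Qed.

Lemma rho_eq0 a : pos a -> rho a = 0 -> a = 0.
Proof.
move=> pa ra; apply: op_inj; apply: hfaithful => //; first exact: opP.
case: htau => _ + _ _ => /(_ _ (opP a) pa); rewrite lecE => /andP[/eqP i0 _].
by apply/eqP; rewrite eq_complex; apply/andP; split; apply/eqP.
Qed.

Lemma eq0_of_rho_sqr b c : adj b c -> rho (c * b) <= 0 -> b = 0.
Proof.
move=> bc le0; have p := pos_sqr bc.
apply: (eq0_of_sqr_le0 bc); rewrite (rho_eq0 p) => [z|].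
  by rewrite oppr0 [op 0 z]/(0 : H) (linear0l form).
by apply/eqP; rewrite eq_le le0 rho_ge0.
Qed.

(** Let A be the absolute value of D and N = A - D, twice the negative part of D.
    Since A^2 = D^2 and A, D commute, D N = - A N, so testing with h = N A N gives
    rho(D h) = - rho((A N)^2) >= 0 and A N = 0.  Then N^2 = A N - D N = 0, that is
    D = A >= 0. *)
Lemma pos_of_rho D : adj D D -> (forall h, pos h -> 0 <= rho (D * h)) -> pos D.
Proof.
move=> aD hD; have [A [pA AA AD]] := sqrt_ex hH hwot aD.
have aA := pos_adj pA.
pose N := A - D.
have aN : adj N N by exact: adjB.
have NA : N * A = A * N by rewrite /N mulrBl mulrBr AD.
have DN : D * N = - (A * N) by rewrite /N !mulrBr AA AD opprB.
have AN0 : A * N = 0.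
  apply: (eq0_of_rho_sqr (adjM aA aN)); rewrite -oppr_ge0 -rhoN.
  have -> : - (N * A * (A * N)) = D * (N * A * N).
    by rewrite !mulrA DN !mulNr -NA.
  by apply: hD; exact: pos_conj.
suff /subr0_eq <- : N = 0 by [].
apply: (eq0_of_rho_sqr aN).
by rewrite {1}/N mulrBl DN AN0 oppr0 subrr rho0.
Qed.

(** * Projections minimizing a linear functional *)

Definition minimizer q x :=
  forall a, pos a -> pos (1 - a) -> rho (x * q) <= rho (x * a).

Lemma eq0_of_dominated_linear (L N : R) :
  (forall e, e ^+ 2 * N <= e * L) -> L = 0.
Proof.
move=> h; apply/eqP/negPn/negP => L0.
have d0 : 0 < `|N| + 1 by rewrite ltr_wpDl.
have L2 : 0 < L ^+ 2 by rewrite exprn_even_gt0.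
pose d := (`|N| + 1)^-1.
have d1 : 0 < d by rewrite invr_gt0.
have dN : d * - N < 1.
  by rewrite mulrC ltr_pdivrMr// mul1r (le_lt_trans (ler_norm _))// normrN ltrDl.
(* At e = - d L the two sides are of second and first order in d, with d small
   enough for the first order term to win unless L = 0. *)
have := h (- (d * L)).
have -> : (- (d * L)) ^+ 2 * N = - (d * L ^+ 2) * (d * - N) by ring.
have -> : - (d * L) * L = - (d * L ^+ 2) by ring.
have : 0 < d * L ^+ 2 by rewrite mulr_gt0.
nra.
Qed.

(** Let k = [x, q], which is skew-adjoint, and let c bound its norm.  The element
    (1 + e k) q (1 - e k) / (1 + e^2 c^2) is in the unit interval, because
    (1 + e k) (1 - e k) = 1 - e^2 k^2 <= 1 + e^2 c^2, and plays the role of the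
    rotated projection exp(e k) q exp(- e k).  The trace property turns the first
    order term of rho(x _) at q into - e rho(k^2), and comparison with the value
    at q for all real e shows that rho(k^2) = - rho(k^* k) is 0. *)
Lemma minimizer_comm q x : adj q q -> q * q = q -> adj x x ->
  minimizer q x -> x * q = q * x.
Proof.
move=> aq qq ax hmin; apply/eqP; rewrite -subr_eq0; apply/eqP.
have [k kE] : exists k, k = x * q - q * x by exists (x * q - q * x).
have ak : adj k (- k) by rewrite kE opprB; apply: adjB; exact: adjM.
rewrite -kE.
have pq := pos_idem aq qq.
have pq' := pos_idem (adjB (@adj1 _ _ _ _ _ _) aq) (idem_compl qq).
have [c c0 kc] := bnd_ex k.
have pK : pos ((c * c)%:A + k * k).
  rewrite -[k * k]opprK -mulNr; apply: (pos_of_bnd hH).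
    by have := adjM (adj_sym ak) ak.
  by apply: bndM => //; exact: bndN.
apply: (eq0_of_rho_sqr ak); rewrite mulNr rhoN.
suff -> : - rho (k * k) = 0 by [].
apply: (@eq0_of_dominated_linear _ (rho (x * q) * (c * c) + rho (x * k * q * k))).
move=> e.
pose u := 1 + e *: k; pose u' := 1 - e *: k.
have au : adj u' u.
  by rewrite /u -[k]opprK scalerN; apply: adjB => //; exact/adjZ.
pose m := 1 + e ^+ 2 * (c * c).
have m0 : 0 < m.
  by rewrite ltr_wpDr// mulr_ge0 ?sqr_ge0// mulr_ge0.
have uu : u * u' = 1 - e ^+ 2 *: (k * k).
  rewrite mulrDl mul1r mulrBr mulr1 -scalerAl -scalerAr scalerA -expr2.
  by rewrite addrA subrK.
have puqu : pos (u * q * u') by exact: pos_conj.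
have puqu' : pos (m%:A - u * q * u').
  have -> : m%:A - u * q * u' = u * (1 - q) * u' + e ^+ 2 *: ((c * c)%:A + k * k).
    have -> : u * (1 - q) * u' = u * u' - u * q * u'.
      by rewrite [u * _]mulrBr mulr1 [LHS]mulrBl.
    rewrite uu /m scalerDl scale1r scalerDr scalerA [LHS]addrAC.
    by rewrite [1 - _ - _]addrAC [_ + _ *: (k * k)]addrC addrA subrK.
  by apply: posD; [exact: pos_conj | apply: posZ => //; exact: sqr_ge0].
have mi : 0 <= m^-1 by rewrite invr_ge0 ltW.
have := hmin (m^-1 *: (u * q * u')) (posZ mi puqu).
have -> : 1 - m^-1 *: (u * q * u') = m^-1 *: (m%:A - u * q * u').
  by rewrite [RHS]scalerBr scalerA mulVf ?scale1r// lt0r_neq0.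
move=> /(_ (posZ mi puqu')).
rewrite -scalerAr rhoZ mulrC ler_pdivlMr//.
have -> : u * q * u' = q + e *: (k * q) - e *: (q * k) - e ^+ 2 *: (k * q * k).
  rewrite /u /u' mulrDl mul1r mulrBr mulr1 -!scalerAl -!scalerAr [(q + _) * k]mulrDl.
  by rewrite -scalerAl scalerDr scalerA -expr2 opprD addrA.
have -> : rho (k * k) = rho (x * q * k) - rho (x * k * q).
  by rewrite {1}kE mulrBl rhoB [rho (x * k * q)]rhoC !mulrA.
rewrite 2!mulrBr [x * (q + _)]mulrDr 2!rhoB rhoD.
rewrite -!(scalerAr _ x) !rhoZ !mulrA /m; nra.
Qed.

Lemma rho_compress q y a : q * q = q -> y * q = q * y ->
  rho (y * (q * a * q)) = rho (y * q * a).
Proof.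
by move=> qq yq; rewrite !mulrA rhoC !mulrA -yq -(mulrA y) qq.
Qed.

Section Minimizer.
Context (q x : E).
Context (aq : adj q q) (qq : q * q = q) (ax : adj x x).
Context (hmin : minimizer q x).

Let p := 1 - q.

(** The competitor q - q h q = q (1 - h) q is again in the unit interval. *)
Lemma minimizer_rho_le0 h : pos h -> pos (1 - h) -> rho (x * (q * h * q)) <= 0.
Proof.
move=> ph ph'.
have := hmin (a := q - q * h * q).
have -> : q - q * h * q = q * (1 - h) * q by rewrite mulrBr mulr1 mulrBl qq.
have -> : 1 - q * (1 - h) * q = q * h * q + p * p.
  rewrite /p !mulrBr !mulrBl !mulr1 !mul1r qq subrr subr0.
  by rewrite opprB addrCA.
move=> /(_ (pos_conj aq ph') (posD (pos_conj aq ph) _)).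
have ap : adj p p by exact: adjB.
move=> /(_ (pos_sqr ap)); rewrite mulrBr mulr1 mulrBl qq mulrBr rhoB.
by lra.
Qed.

(** The competitor is q + p h p. *)
Lemma minimizer_rho_ge0 h : pos h -> pos (1 - h) -> 0 <= rho (x * (p * h * p)).
Proof.
move=> ph ph'.
have ap : adj p p by exact: adjB.
have := hmin (a := q + p * h * p).
have pp : p * p = p := idem_compl qq.
have -> : 1 - (q + p * h * p) = p * (1 - h) * p.
  by rewrite opprD addrA -/p [p * (1 - h)]mulrBr mulr1 [RHS]mulrBl pp.
move=> /(_ (posD _ (pos_conj ap ph)) (pos_conj ap ph')).
rewrite -{1}qq => /(_ (pos_sqr aq)).
by rewrite mulrDr rhoD; lra.
Qed.

End Minimizer.

(** The off-diagonal corners of a do not contribute to the trace against an element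
    commuting with q. *)
Lemma rho_peirce q y a : q * q = q -> y * q = q * y ->
  rho (y * a) = rho (y * (q * a * q)) + rho (y * ((1 - q) * a * (1 - q))).
Proof.
move=> qq yq.
have pp := idem_compl qq.
have yp : y * (1 - q) = (1 - q) * y by rewrite mulrBr mulrBl mulr1 mul1r yq.
rewrite !rho_compress// -rhoD -mulrDl -mulrDr.
by rewrite [q + _]addrC subrK mulr1.
Qed.

(** Since p a p = 0, compressing a - a^2 >= 0 by p gives - (a p)^* (a p) >= 0. *)
Lemma mul_eq0_of_compress p a : adj p p -> pos a -> pos (1 - a) ->
  p * a * p = 0 -> a * p = 0.
Proof.
move=> ap pa pa' pap; have aa := pos_adj pa.
apply: (eq0_of_sqr_le0 (adjM aa ap)).
have := pos_conj ap (pos_unit_sub_sqr pa pa').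
by rewrite mulrBr mulrBl pap sub0r !mulrA.
Qed.

Section TwoMinimizers.
Context (q c : E) (s1 s2 : R).
Context (aq : adj q q) (qq : q * q = q) (ac : adj c c) (s12 : s1 < s2).
Context (min1 : minimizer q (c - s1%:A)).
Context (min2 : minimizer q (c - s2%:A)).

Local Notation p := (1 - q).

Let ap : adj p p.
Proof. exact: adjB. Qed.

Let shift_comm s : (c - s%:A) * q = q * (c - s%:A).
Proof.
have cq : c * q = q * c.
  have := minimizer_comm aq qq (adjB ac (adjA hM nz s1)) min1.
  by rewrite mulrBl mulrBr mulr_algl mulr_algr => /addIr.
by rewrite mulrBl mulrBr mulr_algl mulr_algr cq.
Qed.

Let rho_shift s a : rho ((c - s%:A) * a) = rho (c * a) - s * rho a.
Proof. by rewrite mulrBl mulr_algl rhoB rhoZ. Qed.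

(** For each i, the difference of the two values is
    rho((c - s_i) p a p) - rho((c - s_i) q (1 - a) q), where the first term is
    nonnegative and the second nonpositive: both are 0.  Subtracting the two
    values of i leaves (s2 - s1) rho(p a p) = 0 and the same for q (1 - a) q. *)
Lemma two_minimizers_unique a : pos a -> pos (1 - a) ->
  rho ((c - s1%:A) * a) = rho ((c - s1%:A) * q) ->
  rho ((c - s2%:A) * a) = rho ((c - s2%:A) * q) -> a = q.
Proof.
move=> pa pa' eq1 eq2.
have split s : rho ((c - s%:A) * a) - rho ((c - s%:A) * q) =
    rho ((c - s%:A) * (p * a * p)) - rho ((c - s%:A) * (q * (1 - a) * q)).
  rewrite -rhoB -mulrBr (rho_peirce (a - q) qq (shift_comm s)) [LHS]addrC.
  have -> : p * (a - q) * p = p * a * p.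
    rewrite [p * (a - q)]mulrBr [LHS]mulrBl -[p * q * p]mulrA [q * p]mulrBr.
    by rewrite mulr1 qq subrr mulr0 subr0.
  have -> : q * (a - q) * q = - (q * (1 - a) * q).
    by rewrite -mulNr -mulrN opprB !mulrBr !mulrBl mulr1 !qq.
  by rewrite mulrN rhoN.
have le1 := minimizer_rho_le0 aq qq min1 pa'.
have le2 := minimizer_rho_le0 aq qq min2 pa'.
rewrite subKr in le1 le2.
have ge1 := minimizer_rho_ge0 aq qq min1 pa pa'.
have ge2 := minimizer_rho_ge0 aq qq min2 pa pa'.
have := split s1; have := split s2; rewrite eq1 eq2 !subrr.
move: (le1 pa) (le2 pa) ge1 ge2; rewrite !rho_shift => l1 l2 g1 g2 e2 e1.
have s0 : s2 - s1 != 0 by rewrite subr_eq0 gt_eqF.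
have pap : p * a * p = 0.
  by apply: rho_eq0; [exact: pos_conj | apply: (mulfI s0); lra].
have qaq : q * (1 - a) * q = 0.
  by apply: rho_eq0; [exact: pos_conj | apply: (mulfI s0); lra].
have h1 := mul_eq0_of_compress ap pa pa' pap.
have h2 : (1 - a) * q = 0.
  by apply: mul_eq0_of_compress => //; rewrite subKr.
move: h1 h2; rewrite mulrBr mulr1 mulrBl mul1r => h1 h2.
by rewrite [LHS](subr0_eq h1) -(subr0_eq h2).
Qed.

(** On the range of q the element y = c - s is at most s1 - s, by the minimality for
    s1, and on that of p it is at least s2 - s, by the minimality for s2.  So
    multiplying y by the symmetry p - q makes it positive and bounded below. *)
Lemma two_minimizers_gap s : s1 < s < s2 ->
  exists w, (c - s%:A) * w = 1 /\ w * (c - s%:A) = 1.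
Proof.
move=> /andP[s1s ss2]; have [y yE] : exists y, y = c - s%:A by exists (c - s%:A).
rewrite -yE.
pose r := q - p.
have yq : y * q = q * y by rewrite yE shift_comm.
have yr : y * r = r * y.
  by rewrite /r !(mulrBr, mulrBl) mulr1 mul1r yq.
have ar : adj r r by exact: adjB.
pose Z := - (y * r).
have aZ : adj Z Z.
  apply: adjN; rewrite {2}yr; apply: adjM => //; rewrite yE.
  exact: adjB ac (adjA _ _ _).
pose d := Num.min (s - s1) (s2 - s).
have d0 : 0 < d by rewrite lt_min !subr_gt0 s1s.
have Zd h : pos h -> pos (1 - h) -> d * rho h <= rho (Z * h).
  move=> ph ph'.
  have m1 := minimizer_rho_le0 aq qq min1 ph ph'.
  have m2 := minimizer_rho_ge0 aq qq min2 ph ph'.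
  have pp := idem_compl qq.
  have yp : y * p = p * y by rewrite mulrBr mulrBl mulr1 mul1r yq.
  have -> : rho (Z * h) = rho (y * (p * h * p)) - rho (y * (q * h * q)).
    by rewrite !rho_compress// -rhoB -mulrBl -mulrBr -opprB mulrN.
  have -> : rho h = rho (q * h * q) + rho (p * h * p).
    rewrite -[h in LHS]mul1r (rho_peirce h qq) ?mul1r//.
    by rewrite mulr1.
  move: m1 m2; rewrite yE !rho_shift.
  have Q0 : 0 <= rho (q * h * q) by exact/rho_ge0/pos_conj.
  have P0 : 0 <= rho (p * h * p) by exact/rho_ge0/pos_conj.
  have dQ : d * rho (q * h * q) <= (s - s1) * rho (q * h * q).
    by apply: ler_wpM2r => //; rewrite ge_min lexx.
  have dP : d * rho (p * h * p) <= (s2 - s) * rho (p * h * p).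
    by apply: ler_wpM2r => //; rewrite ge_min lexx orbT.
  lra.
have pZ : pos (Z - d%:A).
  apply: pos_of_rho; first by apply: adjB aZ (adjA _ _ _).
  move=> h ph; have [k k0 hk] := bnd_ex h.
  have k1 : 0 < k + 1 by rewrite ltr_wpDl.
  have k1' : 0 <= (k + 1)^-1 by rewrite invr_ge0 ltW.
  have := Zd ((k + 1)^-1 *: h) (posZ k1' ph).
  have -> : 1 - (k + 1)^-1 *: h = (k + 1)^-1 *: ((k + 1)%:A - h).
    by rewrite [RHS]scalerBr scalerA mulVf ?scale1r// lt0r_neq0.
  have pkh : pos ((k + 1)%:A - h).
    by apply: (pos_of_bnd hH (pos_adj ph)); apply: bnd_le hk; rewrite lerDl.
  move=> /(_ (posZ k1' pkh)); rewrite -scalerAr !rhoZ mulrCA.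
  rewrite ler_pM2l ?invr_gt0// => hle.
  by rewrite mulrBl mulr_algl rhoB rhoZ subr_ge0.
have [W [ZW WZ]] := inv_ex hH hwot d0 pZ.
have yW : y * - (r * W) = 1 by rewrite mulrN mulrA -mulNr.
have Wy : - (W * r) * y = 1 by rewrite mulNr -mulrA -yr -mulrN.
exists (- (r * W)); split => //.
have <- // : - (W * r) = - (r * W).
by rewrite -[LHS]mulr1 -yW mulrA Wy mul1r.
Qed.

End TwoMinimizers.

End Trace.

(** * The spectral scale *)

Lemma tracial_state_id_neq0 (R : realType) (H : completeNormedModType R[i])
    (form : {dot H for Num.conj}) (M : set (H -> H)) (tau : (H -> H) -> R[i]) :
  star_subalgebra form M -> tracial_state form M tau -> (id : H -> H) <> 0.
Proof.
move=> hM [lin _ tau1 _] id0.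
have M0 := star_subalgebra0 hM.
have := lin 1 _ _ M0 M0; rewrite scaler0 add0r mul1r => /esym.
move=> /(canRL (addrK _)); rewrite subrr -id0 tau1 => /eqP.
by rewrite oner_eq0.
Qed.

Section SpectralScale.
Context (R : realType) (H : completeNormedModType R[i]).
Context (form : {dot H for Num.conj}) (M : set (H -> H)).
Context (hM : star_subalgebra form M) (nz : (id : H -> H) <> 0).
Context (tau : (H -> H) -> R[i]).
Context (htau : tracial_state form M tau).
Context (n : nat) (B : 'I_n -> elt hM nz).

Local Notation E := (elt hM nz).
Local Notation b := (fun i => op (B i)).

Lemma op_sum (t : 'rV[R]_n) : op (\sum_i t 0 i *: B i) = lin_comb b t.
Proof.
rewrite /lin_comb; apply: (big_ind2 (fun (a : E) c => op a = c)) => //.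
by move=> a c a' c' <- <-.
Qed.

Lemma rho_sum (f : 'I_n -> E) : rho tau (\sum_i f i) = \sum_i rho tau (f i).
Proof.
apply: (big_ind2 (fun (a : E) r => rho tau a = r)) => //.
  exact: rho0 htau.
by move=> a r a' r' <- <-; exact: rhoD htau _ _.
Qed.

(** This turns supporting hyperplanes of the spectral scale into minima of trace
    functionals. *)
Lemma dotv_spectral_map (s : R) (t : 'rV[R]_n) (a : E) :
  dotv (row_mx (- s)%:M t) (spectral_map tau b (op a))
    = rho tau ((\sum_i t 0 i *: B i - s%:A) * a).
Proof.
rewrite /dotv big_split_ord /= big_ord1 !row_mxEl !mxE eqxx !mulr1n.
rewrite mulrBl mulr_algl rhoB// rhoZ// mulr_suml rho_sum addrC mulNr.
congr (_ - _); apply: eq_bigr => i _.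
by rewrite !row_mxEr !mxE -scalerAl rhoZ.
Qed.

End SpectralScale.

Theorem corollary4p9 (R : realType) (H : completeNormedModType R[i])
    (form : {dot H for Num.conj}) (M : set (H -> H))
    (tau : (H -> H) -> R[i]) (n : nat) (b : 'I_n -> H -> H)
    (hH : hilbert form)
    (hM : von_neumann_algebra form M) (hfin : finite_vna form M)
    (htau : tracial_state form M tau) (hfaithful : faithful form M tau)
    (hnormal : normal form M tau)
    (hn : (0 < n)%N)
    (hb : forall i, M (b i) /\ selfadjoint form (b i))
    (qm qp : H -> H)
    (hqm : generated_vna form b qm /\ projection form qm)
    (hqp : generated_vna form b qp /\ projection form qp)
    (hq : op_le form qm qp)
    (F : set 'rV[R]_(1 + n))
    (hF : F = spectral_map tau b @` op_itv form M qm qp)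
    (hface : face (spectral_scale form M tau b) F)
    (t : 'rV[R]_n) (ht : t != 0)
    (s1 s2 : R) (hs : s1 < s2)
    (hs1 : normal_cone (spectral_scale form M tau b) F (row_mx (- s1)%:M t))
    (hs2 : normal_cone (spectral_scale form M tau b) F (row_mx (- s2)%:M t)) :
  [set s%:C | s in `]s1, s2[] `&` spectrum M (lin_comb b t) = set0 /\
  exists x, exposed_point (spectral_scale form M tau b) x /\ F = [set x].
Proof.
have Mb i : M (b i) by have [] := hb i.
have Mqm : M qm by case: hqm => /(_ M hM Mb).
have [hsub hwot] := hM.
have nz := tracial_state_id_neq0 hsub htau.
pose B i : elt hsub nz := exist _ (b i) (Mb i).
pose q : elt hsub nz := exist _ qm Mqm.
pose c := \sum_i t 0 i *: B i.
have aq : adj q q by case: hqm => _ [].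
have qq : q * q = q by apply: op_inj; case: hqm => _ [].
have ac : adj c c.
  apply: (big_ind (fun a : elt hsub nz => adj a a)) => [x y|a a'|i _].
  - by rewrite (linear0l form) (linear0r form).
  - exact: adjD.
  - by apply: adjZ; have [] := hb i.
have pq := pos_idem aq qq.
have pq' := pos_idem (adjB (@adj1 _ _ _ _ _ _) aq) (idem_compl qq).
have unitP (a : elt hsub nz) : pos a -> pos (1 - a) ->
    unit_interval form M (op a).
  by move=> pa pa'; split; [exact: opP | rewrite /op_le subr0 | exact: pa'].
have unit_elt a : unit_interval form M a ->
    exists a' : elt hsub nz, [/\ op a' = a, pos a' & pos (1 - a')].
  case=> Ma; rewrite /op_le subr0 => a0 a1.
  by exists (exist _ a Ma : elt hsub nz).
have Fq : F (spectral_map tau b qm).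
  rewrite hF; exists qm => //; split=> //; first exact: (unitP q).
  by rewrite /op_le subrr => x; rewrite (linear0l form).
have dotE s (a : elt hsub nz) : dotv (row_mx (- s)%:M t) (spectral_map tau b (op a))
    = rho tau ((c - s%:A) * a) by exact: (dotv_spectral_map htau B).
have cone s : normal_cone (spectral_scale form M tau b) F (row_mx (- s)%:M t) ->
    minimizer tau q (c - s%:A) /\
    forall a : elt hsub nz, F (spectral_map tau b (op a)) ->
      rho tau ((c - s%:A) * a) = rho tau ((c - s%:A) * q).
  case=> _ [alpha [_ Fh Bh]].
  have eq_q : rho tau ((c - s%:A) * q) = alpha by rewrite -dotE; exact: Fh.
  split=> [a pa pa'|a /Fh].
    by rewrite eq_q -dotE; apply: Bh; exists (op a) => //; exact: unitP.
  by rewrite /hyperplane /= dotE eq_q.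
have [min1 F1] := cone _ hs1; have [min2 F2] := cone _ hs2.
split.
  apply/seteqP; split => // l [[s ss <-]]; apply => {l}.
  move: ss; rewrite /= in_itv /= => ss.
  have [w [cw wc]] :=
    two_minimizers_gap hH hwot htau hfaithful aq qq ac min1 min2 ss.
  have cE : op (c - s%:A) = lin_comb b t - s%:C *: id.
    by rewrite -[lin_comb b t](op_sum B).
  exists (op w); rewrite -cE; split; first exact: opP.
    exact: (congr1 (@op _ _ _ _ _ _) wc).
  exact: (congr1 (@op _ _ _ _ _ _) cw).
pose s := (s1 + s2) / 2.
have mid (a : elt hsub nz) : rho tau ((c - s%:A) * a) =
    (rho tau ((c - s1%:A) * a) + rho tau ((c - s2%:A) * a)) / 2.
  by rewrite !mulrBl !mulr_algl !(rhoB htau) !(rhoZ htau) /s; field.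
exists (spectral_map tau b qm); split; last first.
  apply/seteqP; split => [x Fx|_ ->//].
  have := Fx; rewrite {1}hF => -[a [ua _ _] ax].
  have [a' [a'E pa pa']] := unit_elt _ ua.
  have Fa : F (spectral_map tau b (op a')) by rewrite a'E ax.
  have := two_minimizers_unique hH htau hfaithful aq qq ac hs min1 min2 pa pa'
    (F1 _ Fa) (F2 _ Fa).
  by move=> a'q; rewrite -ax -a'E a'q.
set v := row_mx (- s)%:M t; pose alpha := rho tau ((c - s%:A) * q).
have qB : (spectral_scale form M tau b `&` hyperplane v alpha)
    (spectral_map tau b qm).
  split; first by exists qm => //; exact: (unitP q).
  exact: (dotE s q).
exists (hyperplane v alpha).
  exists v, alpha; split => //; last by exists (spectral_map tau b qm).
    by apply/eqP => /(congr1 (@rsubmx _ _ _ _)); rewrite row_mxKr linear0; exact/eqP.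
  move=> _ [a /unit_elt[a' [<- pa pa']] <-]; rewrite /halfspace /= dotE /alpha !mid.
  by rewrite ler_pM2r ?invr_gt0// lerD// ?min1 ?min2.
apply/seteqP; split => [_ ->//|_ [[a /unit_elt[a' [<- pa pa']] <-]]].
rewrite /hyperplane /= dotE /alpha !mid => eq_mid.
have le1 := min1 _ pa pa'; have le2 := min2 _ pa pa'.
have -> // : a' = q.
apply: (two_minimizers_unique hH htau hfaithful aq qq ac hs min1 min2 pa pa').
  by lra.
by lra.
Qed.
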